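(* Let $n\ge 7$ and let $G$ be a connected simple graph with $n$ vertices and $n+1$ edges whose two cycles are vertex-disjoint (i.e. $G\in\mathcal{C}(p,q)$ for some $p,q$). If $G\not\cong T_n^1(3,3)$, then $\operatorname{avm}(G)>\operatorname{avm}(T_n^1(3,3))$.
   Context: $\operatorname{avm}(G)$ is the average of $|M|$ over all maximal matchings $M$ of $G$ (a matching is maximal if not properly contained in another matching). $\mathcal{C}(p,q)$ is the class of connected graphs with $n$ vertices and $n+1$ edges containing two vertex-disjoint cycles of lengths $p$ and $q$. $T_n^1(3,3)$ is the graph obtained from two vertex-disjoint triangles $v_1v_2v_3$ and $w_1w_2w_3$ joined by the edge $v_3w_1$ by attaching $n-6\ge1$ pendant edges (new leaves) to $v_3$. *)

(* Defs.v *)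
From mathcomp Require Import all_boot all_order all_algebra.
Set Implicit Arguments. Unset Strict Implicit. Unset Printing Implicit Defensive.
Import Order.TTheory GRing.Theory Num.Theory.

Section Graphs.
Variable T : finType.
Variable e : rel T.

Definition simple_graph : Prop := symmetric e /\ irreflexive e.

Definition edges : {set {set T}} :=
  [set [set x; y] | x in T, y in T & e x y].

Definition connected_graph : Prop := forall x y : T, connect e x y.

Definition matching (M : {set {set T}}) : bool :=
  (M \subset edges) &&
  [forall a in M, forall b in M, (a != b) ==> [disjoint a & b]].

Definition maximal_matching (M : {set {set T}}) : bool :=
  matching M && [forall M' : {set {set T}}, (matching M' && (M \subset M')) ==> (M' == M)].

Definition maximal_matchings : {set {set {set T}}} :=
  [set M | maximal_matching M].

Definition avm : rat :=
  ((\sum_(M in maximal_matchings) #|M|)%:R / #|maximal_matchings|%:R)%R.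

Definition is_graph_cycle (s : seq T) : bool :=
  [&& 3 <= size s, uniq s & cycle e s].

Definition has_two_disjoint_cycles : Prop :=
  exists s1 s2 : seq T, [/\ is_graph_cycle s1, is_graph_cycle s2 &
                           all (fun x => x \notin s2) s1].

End Graphs.

Definition graph_iso (T1 T2 : finType) (e1 : rel T1) (e2 : rel T2) : Prop :=
  exists f : T1 -> T2, bijective f /\ forall x y, e2 (f x) (f y) = e1 x y.

(* T_n^1(3,3) on vertex set 'I_n: v1,v2,v3 = 0,1,2; w1,w2,w3 = 3,4,5;
   leaves 6,...,n-1 attached to v3 = 2; bridge v3 w1 = {2,3}. *)
Definition T1_adj (i j : nat) : bool :=
  [|| (i == 0) && (j == 1), (i == 1) && (j == 2), (i == 0) && (j == 2),
      (i == 3) && (j == 4), (i == 4) && (j == 5), (i == 3) && (j == 5),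
      (i == 2) && (j == 3) | (i == 2) && (6 <= j)].

Definition Tn133 (n : nat) : rel 'I_n :=
  fun i j => T1_adj i j || T1_adj j i.
Arguments Tn133 n : clear implicits.

(* Main.v *)
Require Import Defs.
From mathcomp Require Import all_boot all_order all_algebra zify.
Set Implicit Arguments. Unset Strict Implicit. Unset Printing Implicit Defensive.
Import Order.TTheory GRing.Theory Num.Theory.

(** Put [k = n - 6]. In [T_n^1(3,3)] every maximal matching has size 2 or 3, six of them
    have size 2 and at most [3k + 1] have size 3. In [G] the vertices covered by a
    maximal matching form a vertex cover, which meets each cycle at least twice, so every
    maximal matching has size at least 2. If [G] has [s] maximal matchings of size 2 and
    [l] larger ones, it therefore suffices to prove [s (3k + 1) < 6 l].

    This is clear if [s = 0]. Otherwise a maximal matching of size 2 together with the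
    edge count forces two disjoint triangles [A] and [B] such that the remaining [k]
    vertices are independent; a maximal matching of size 2 is then [{A - a, B - b}] with
    [a], [b] nonadjacent and without neighbours outside [A] and [B], which bounds [s].
    To bound [l], choose for each outside vertex [r] a neighbour [u], say in [A]; for
    every [v] in [B] the matching [{ru, A - u, B - v}] extends to a maximal one, and
    different choices of [(r, v)] are incompatible. If all outside vertices hang on [A],
    the bridge gives one more such matching, so [l >= 3k + 1], while [s <= 6] with
    equality only for [T_n^1(3,3)]. *)

(** * Maximal matchings and vertex covers *)

Section SimpleGraph.
Variables (T : finType) (e : rel T).
Hypotheses (eS : symmetric e) (eI : irreflexive e).
Implicit Types (x y z u v r : T) (m : {set T}) (M F : {set {set T}}).

Lemma edgesP m : reflect (exists x y, e x y /\ m = [set x; y]) (m \in edges e).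
Proof.
apply: (iffP imset2P) => [[x y _] | [x [y [exy ->]]]].
  by rewrite inE => /andP[_ exy] ->; exists x, y.
by exists x y; rewrite ?inE.
Qed.

Lemma in_edges x y : ([set x; y] \in edges e) = e x y.
Proof.
apply/edgesP/idP => [[u [v [euv /setP E]]] | exy]; last by exists x, y.
have := E x; have := E y; have := E u; have := E v; rewrite !inE !eqxx ?orbT.
move=> vxy uxy /esym/orP[]/eqP yE /esym/orP[]/eqP xE; subst x y => //; try by rewrite eS.
  by move: vxy; rewrite orbb => /eqP vu; rewrite vu in euv.
by move: uxy; rewrite orbb => /eqP uv; rewrite uv in euv.
Qed.

Lemma edge_neq x y : e x y -> x != y.
Proof. by apply: contraTneq => ->; rewrite eI. Qed.

Lemma edge_card m : m \in edges e -> #|m| = 2.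
Proof. by case/edgesP => x [y [/edge_neq nxy ->]]; rewrite cards2 nxy. Qed.

Lemma matchingP M : reflect (M \subset edges e /\
    forall a b z, a \in M -> b \in M -> z \in a -> z \in b -> a = b)
  (matching e M).
Proof.
apply: (iffP andP) => -[-> H]; split=> //.
  move=> a b z aM bM za zb; apply/eqP; apply: contraT => nab.
  move/forallP: H => /(_ a) /implyP /(_ aM) /forallP /(_ b) /implyP /(_ bM).
  by move/implyP => /(_ nab) /pred0P /(_ z) /=; rewrite za zb.
apply/forallP => a; apply/implyP => aM; apply/forallP => b; apply/implyP => bM; apply/implyP => nab.
rewrite disjoint_subset; apply/subsetP => z za; rewrite inE.
by apply: contra nab => zb; apply/eqP; apply: (H a b z).
Qed.

Lemma card_cover_matching M : matching e M -> #|cover M| = #|M| * 2.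
Proof.
case/matchingP => /subsetP sME dM.
have tM : trivIset M.
  apply/trivIsetP => a b aM bM; apply: contraR.
  by case/pred0Pn => z /andP[/= za zb]; apply/eqP; apply: (dM a b z).
rewrite -(eqP tM) (eq_bigr (fun=> 2)) ?sum_nat_const // => m /sME; exact: edge_card.
Qed.

(** An edge with both ends uncovered could be added to [M]. Conversely, every edge of a larger
    matching [M'] meets an edge of [M] and, by disjointness in [M'], equals it. *)
Lemma maximal_matchingP M : reflect (matching e M /\
    forall x y, e x y -> (x \in cover M) || (y \in cover M))
  (maximal_matching e M).
Proof.
apply: (iffP andP) => -[mM H]; split=> //.
  move=> x y exy; apply: contraT; rewrite negb_or => /andP[xM yM].
  have out z m : m \in M -> z \in m -> z \in cover M by move=> mM' zm; apply/bigcupP; exists m.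
  have mM' : matching e ([set x; y] |: M).
    have [sME dM] := matchingP _ mM.
    apply/matchingP; split; first by rewrite subUset sub1set in_edges exy.
    move=> a b z; rewrite !inE => /orP[/eqP->|aM] /orP[/eqP->|bM] //; last exact: dM.
      by rewrite !inE => /orP[]/eqP-> zb; [rewrite (out x b) in xM | rewrite (out y b) in yM].
    by rewrite !inE => za /orP[]/eqP zE; subst z; [rewrite (out x a) in xM | rewrite (out y a) in yM].
  move/forallP: H => /(_ ([set x; y] |: M)) /implyP; rewrite mM' subsetUr => /(_ isT) /eqP E.
  have xyM : [set x; y] \in M by rewrite -E !inE eqxx.
  by move: xM; rewrite (out x _ xyM) // !inE eqxx.
apply/forallP => M'; apply/implyP => /andP[mM' sMM'].
rewrite eqEsubset sMM' andbT; apply/subsetP => m mM1.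
have [/subsetP sME dM] := matchingP _ mM'.
have [x [y [exy Em]]] := edgesP _ (sME _ mM1).
have aux z : z \in m -> z \in cover M -> m \in M.
  move=> zm /bigcupP[b bM zb].
  by rewrite (dM m b z) // (subsetP sMM').
by case/orP: (H _ _ exy); apply: aux; rewrite Em !inE eqxx ?orbT.
Qed.

Lemma matching_extend F : matching e F ->
  exists2 M, maximal_matching e M & F \subset M.
Proof.
move=> mF; have [M /maxsetP[mM maxM] sFM] := maxset_exists mF.
exists M => //; apply/andP; split=> //; apply/forallP => M'; apply/implyP => /andP[mM' sM].
by rewrite (maxM _ mM' sM).
Qed.

Lemma matching0 : matching e set0.
Proof. by apply/matchingP; split; [apply: sub0set | move=> a b z; rewrite inE]. Qed.

(* [small_maximal] and [large_maximal] exhaust the maximal matchings only when there are none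
   of size less than 2. *)
Definition small_maximal := [set M in maximal_matchings e | #|M| == 2].
Definition large_maximal := [set M in maximal_matchings e | 2 < #|M|].

(** Distinct edges through a common vertex [z] prevent [F] and [F'] from lying in one matching. *)
Definition incompatible F F' :=
  exists a b z, [/\ a \in F, b \in F', z \in a, z \in b & a != b].

Lemma incompatible_sym F F' : incompatible F F' -> incompatible F' F.
Proof. by move=> [a [b [z [*]]]]; exists b, a, z; split; rewrite // eq_sym. Qed.

(** Each [F i] extends to a maximal matching, and incompatibility makes the chosen extensions
    distinct. *)
Lemma card_large_ge (J : finType) (I : {set J}) (F : J -> {set {set T}}) :
  (forall i, i \in I -> matching e (F i) /\ 2 < #|F i|) ->
  (forall i j, i \in I -> j \in I -> i != j -> incompatible (F i) (F j)) ->
  #|I| <= #|large_maximal|.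
Proof.
move=> HF inc.
pose g i := odflt set0 [pick M | maximal_matching e M && (F i \subset M)].
have gP i : i \in I -> maximal_matching e (g i) && (F i \subset g i).
  case/HF => mF _; rewrite /g; case: pickP => [M //|] /= H.
  by have [M mM sM] := matching_extend mF; move: (H M); rewrite mM sM.
have injg : {in I &, injective g}.
  move=> i j iI jI E; apply/eqP; apply: contraT => nij.
  have [a [b [z [aF bF za zb nab]]]] := inc _ _ iI jI nij.
  have /andP[/andP[/matchingP[_ dM] _] sF] := gP _ iI.
  have /andP[_ sFj] := gP _ jI; rewrite -E in sFj.
  by move: nab; rewrite (dM a b z (subsetP sF _ aF) (subsetP sFj _ bF) za zb) eqxx.
rewrite -(card_in_imset injg); apply/subset_leq_card/subsetP => _ /imsetP[i iI ->].
have /andP[mg sF] := gP _ iI; have [_ cF] := HF _ iI.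
by rewrite !inE mg (leq_trans cF) // subset_leq_card.
Qed.

(** After rotating the cycle to start at [x], take the second and the last vertex; they differ
    because the length is at least 3. *)
Lemma cycle_neighbours s x : is_graph_cycle e s -> x \in s ->
  exists u v, [/\ u \in s, v \in s, u != v, e x u & e x v].
Proof.
case/and3P => sz us cs xs.
have [i s' Es] := rot_to xs.
have us' : uniq (x :: s') by rewrite -Es rot_uniq.
have cs' : cycle e (x :: s') by rewrite -Es rot_cycle.
have sz' : 2 < size (x :: s') by rewrite -Es size_rot.
have ms y : (y \in s) = (y \in x :: s') by rewrite -Es mem_rot.
case: s' {Es} us' cs' sz' ms => [//|u [//|w s']] us' cs' _ ms.
exists u, (last w s'); rewrite !ms.
move: cs'; rewrite /= rcons_path => /and4P[exu _ _ elx].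
move: us' => /= /and4P[_ nu _ _].
split=> //; first by rewrite !inE eqxx orbT.
- by rewrite !inE; have := mem_last w s'; rewrite inE => /orP[->|->]; rewrite ?orbT.
- by apply: contraNneq nu => ->; rewrite mem_last.
- by rewrite eS.
Qed.

Lemma cycle_size s : is_graph_cycle e s -> 2 < #|[set x in s]|.
Proof. by case/and3P => sz us _; rewrite cardsE (card_uniqP us). Qed.

Definition inner_edges (X : {set T}) := [set m in edges e | m \subset X].

(* Double counting of incidences. *)
Lemma card_inner_edges (X : {set T}) :
  (forall x, x \in X -> exists u v, [/\ u \in X, v \in X, u != v, e x u & e x v]) ->
  #|X| <= #|inner_edges X|.
Proof.
move=> H; rewrite -(leq_pmul2r (isT : 0 < 2)).
have -> : #|inner_edges X| * 2 = \sum_(m in inner_edges X) \sum_(x in X) (x \in m).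
  rewrite -sum_nat_const; apply: eq_bigr => m; rewrite inE => /andP[mE sm].
  rewrite -(edge_card mE) -sum1_card [RHS](big_setID m) /= (setIidPr sm) [X in _ = _ + X]big1 ?addn0.
    by apply: eq_bigr => x ->.
  by move=> x; rewrite inE => /andP[/negbTE->].
rewrite exchange_big /= -sum_nat_const; apply: leq_sum => x xX.
have [u [v [uX vX nuv exu exv]]] := H _ xX.
have ne : [set x; u] != [set x; v].
  apply/eqP => /setP /(_ u); rewrite !inE eqxx orbT (negbTE nuv) orbF.
  by rewrite eq_sym (negbTE (edge_neq exu)).
have inn w : w \in X -> e x w -> [set x; w] \in inner_edges X.
  by move=> wX exw; rewrite !inE in_edges exw; apply/subsetP=> z; rewrite !inE => /orP[]/eqP->.
rewrite (bigD1 [set x; u]) ?inn //= (bigD1 [set x; v]) /= ?inn // 1?eq_sym //.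
by rewrite !inE eqxx.
Qed.

(** If some vertex of the cycle is not in [C], its two neighbours on the cycle are; otherwise any
    adjacent pair will do. *)
Lemma vertex_cover_cycle s (C : {set T}) : is_graph_cycle e s ->
  (forall x y, e x y -> (x \in C) || (y \in C)) ->
  1 < #|C :&: [set x in s]|.
Proof.
move=> cs cov; have [x xs] : exists x, x \in s.
  by case/and3P: cs; case: s => // x s _ _ _; exists x; rewrite inE eqxx.
have two u v : u \in s -> v \in s -> u \in C -> v \in C -> u != v ->
    1 < #|C :&: [set x in s]|.
  by move=> us vs uC vC nuv; apply/card_gt1P; exists u, v; rewrite !inE us vs uC vC.
have [u [v [us vs nuv exu exv]]] := cycle_neighbours cs xs.
have [xC|xC] := boolP (x \in C); last first.
  by apply: (two u v) => //; [move: (cov _ _ exu) | move: (cov _ _ exv)]; rewrite (negbTE xC).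
have [uC|uC] := boolP (u \in C); first by apply: (two x u) => //; apply: edge_neq.
have [w [w' [ws ws' nw euw euw']]] := cycle_neighbours cs us.
have H z : e u z -> z \in C by move=> /cov; rewrite (negbTE uC).
by apply: (two w w'); rewrite ?H.
Qed.

End SimpleGraph.

(** * Maximal matchings of size two *)

Lemma card_setU_disjoint (T : finType) (A B : {set T}) :
  (forall x, x \in A -> x \notin B) -> #|A :|: B| = #|A| + #|B|.
Proof.
move=> dAB; rewrite cardsU (_ : A :&: B = set0) ?cards0 ?subn0 //.
by apply/setP => x; rewrite !inE; case: (boolP (x \in A)) => // /dAB /negbTE.
Qed.

Definition triangle (T : finType) (e : rel T) (A : {set T}) :=
  #|A| = 3 /\ {in A &, forall x y, x != y -> e x y}.

Section Bicyclic.
Variables (T : finType) (e : rel T).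
Hypotheses (eS : symmetric e) (eI : irreflexive e) (conn : connected_graph e).
Hypothesis cardE : #|edges e| = #|T|.+1.
Implicit Types (x y z u v r : T) (m X Y : {set T}) (M F : {set {set T}}).

Lemma has_neighbour r : 1 < #|T| -> exists u, e r u.
Proof.
move=> T1; have [z nzr] : exists z, z != r.
  apply/existsP; apply: contraLR T1 => /existsPn H; rewrite -leqNgt.
  rewrite -(card1 r); apply/subset_leq_card/subsetP => x _; rewrite inE.
  by move: (H x); rewrite negbK.
have /connectP[[|u p] /= ep lp] := conn r z; first by rewrite lp eqxx in nzr.
by exists u; case/andP: ep.
Qed.

(* [X] and [Y] carry at least [#|X| + #|Y|] edges and each outside vertex [r] its own edge
   [{r, t r}], so only one of the [#|T| + 1] edges is left. *)
Lemma extra_edge_unique X Y (t : T -> T) m1 m2 :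
  [disjoint X & Y] -> #|X| <= #|inner_edges e X| -> #|Y| <= #|inner_edges e Y| ->
  (forall r, r \notin X -> r \notin Y -> e r (t r) /\ (t r \in X :|: Y)) ->
  (forall m, m \in [set m1; m2] -> [/\ m \in edges e, ~~ (m \subset X), ~~ (m \subset Y) &
     forall r, r \notin X -> r \notin Y -> m != [set r; t r]]) ->
  m1 = m2.
Proof.
move=> dXY cX cY ht hm; apply/eqP; apply: contraT => nm.
pose Rs := ~: (X :|: Y).
have RsP r : r \in Rs -> [/\ r \notin X, r \notin Y, e r (t r) & t r \notin Rs].
  by rewrite !inE negb_or => /andP[rX rY]; have [? tr] := ht _ rX rY; rewrite -in_setU tr.
pose Phi := [set [set r; t r] | r in Rs].
(* The edge determines [r], since its other end [t r] is not an outside vertex. *)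
have cPhi : #|Phi| = #|Rs|.
  apply: card_in_imset => r r' rR r'R /setP /(_ r); rewrite !inE eqxx /=.
  case/esym/orP => /eqP // E; have [_ _ _] := RsP _ r'R; by rewrite -E rR.
have dIn : #|inner_edges e X :|: inner_edges e Y| = #|inner_edges e X| + #|inner_edges e Y|.
  apply: card_setU_disjoint => m; rewrite !inE => /andP[mE mX]; rewrite mE /=.
  apply/negP => mY; have := edge_card eI mE.
  have : m \subset X :&: Y by rewrite subsetI mX mY.
  by rewrite (disjoint_setI0 dXY) subset0 => /eqP->; rewrite cards0.
have d2 : #|(inner_edges e X :|: inner_edges e Y) :|: [set m1; m2]|
    = #|inner_edges e X :|: inner_edges e Y| + 2.
  rewrite card_setU_disjoint ?cards2 ?nm // => m mI; apply/negP => /hm[mE nX nY _].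
  by move: mI; rewrite !inE (negbTE nX) (negbTE nY) !andbF.
have d3 : #|((inner_edges e X :|: inner_edges e Y) :|: [set m1; m2]) :|: Phi|
    = #|(inner_edges e X :|: inner_edges e Y) :|: [set m1; m2]| + #|Phi|.
  apply: card_setU_disjoint => m mI; apply/negP => /imsetP[r /RsP[rX rY _ _] mr].
  move: mI; rewrite inE => /orP[|/hm[_ _ _ /(_ r rX rY)]]; last by rewrite mr eqxx.
  rewrite !inE -andb_orr => /andP[_] /orP[]/subsetP/(_ r); rewrite mr !inE eqxx.
    by move=> /(_ isT) E; rewrite E in rX.
  by move=> /(_ isT) E; rewrite E in rY.
have cU : #|X :|: Y| = #|X| + #|Y|.
  by apply: card_setU_disjoint => x xX; rewrite (disjointFr dXY xX).
have cR : #|X :|: Y| + #|Rs| = #|T| by rewrite cardsC.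
(* The disjoint families have at least [#|X| + #|Y| + 2 + #|Rs| = #|T| + 2] members, one more than
   there are edges. *)
have : #|((inner_edges e X :|: inner_edges e Y) :|: [set m1; m2]) :|: Phi| <= #|edges e|.
  apply/subset_leq_card/subsetP => m; rewrite inE => /orP[|/imsetP[r /RsP[_ _ etr _] ->]].
    by rewrite inE => /orP[|/hm[]//]; rewrite !inE => /orP[]/andP[].
  by rewrite in_edges.
lia.
Qed.

(** The four covered vertices split two and two. If one edge of [M] crossed between [X] and [Y], it
    would use a covered vertex on each side, so the other edge would cross as well;
    [extra_edge_unique] allows only one such edge. *)
Lemma small_maximal_split X Y M :
  [disjoint X & Y] -> #|X| <= #|inner_edges e X| -> #|Y| <= #|inner_edges e Y| ->
  M \in small_maximal e -> 1 < #|cover M :&: X| -> 1 < #|cover M :&: Y| ->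
  [/\ M = [set cover M :&: X; cover M :&: Y], cover M \subset X :|: Y,
      #|cover M :&: X| = 2 & #|cover M :&: Y| = 2].
Proof.
move=> dXY cX cY; rewrite !inE => /andP[/(maximal_matchingP eS)[mM cov] /eqP M2] CX CY.
have cC := card_cover_matching eI mM; rewrite M2 in cC.
have [/subsetP sME dM] := matchingP _ _ mM.
set C := cover M in cov CX CY cC *.
have cCU : #|C :&: X :|: C :&: Y| = #|C :&: X| + #|C :&: Y|.
  apply: card_setU_disjoint => x; rewrite !inE => /andP[_ xX].
  by rewrite (disjointFr dXY xX) andbF.
have sCU : C :&: X :|: C :&: Y \subset C by rewrite subUset !subsetIl.
have := subset_leq_card sCU; rewrite cCU cC => le4.
have CX2 : #|C :&: X| = 2 by lia.
have CY2 : #|C :&: Y| = 2 by lia.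
have CE : C :&: X :|: C :&: Y = C by apply/eqP; rewrite eqEcard sCU cCU cC CX2 CY2.
have sC : C \subset X :|: Y by rewrite -CE setUSS ?subsetIr.
split=> //.
have sMC m : m \in M -> m \subset C by move=> mM'; apply: bigcup_sup.
(* A chosen neighbour; connectivity ensures that the default [r] never occurs. *)
pose t r := odflt r [pick u | e r u].
have T1 : 1 < #|T| by rewrite -cardsT (leq_trans CX) // subset_leq_card // subsetT.
have ht r : r \notin X -> r \notin Y -> e r (t r) /\ (t r \in X :|: Y).
  move=> rX rY; have er : e r (t r).
    rewrite /t; case: pickP => // H; have [u eu] := has_neighbour r T1.
    by rewrite H in eu.
  split=> //; apply: (subsetP sC); case/orP: (cov _ _ er) => // /(subsetP sC).
  by rewrite !inE (negbTE rX) (negbTE rY).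
have cross m m' : m \in M -> m' \in M -> ~~ (m \subset X) -> ~~ (m \subset Y) ->
    ~~ (m' \subset X) -> ~~ (m' \subset Y) -> m = m'.
  move=> mM1 mM2 a1 a2 b1 b2; apply: (extra_edge_unique dXY cX cY ht) => q.
  have aux q' : q' \in M -> forall r, r \notin X -> r \notin Y -> q' != [set r; t r].
    move=> qM r rX rY; apply/eqP => E; have /subsetP/(_ r) := sMC _ qM.
    by rewrite E !inE eqxx => /(_ isT) /(subsetP sC); rewrite !inE (negbTE rX) (negbTE rY).
  by rewrite !inE => /orP[]/eqP->; split=> //; [apply: sME | apply: aux | apply: sME | apply: aux].
have inX m : m \in M -> m \subset X -> m = C :&: X.
  move=> mM1 mX; apply/eqP; rewrite eqEcard subsetI sMC // mX CX2.
  by rewrite (edge_card eI) ?sME.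
have inY m : m \in M -> m \subset Y -> m = C :&: Y.
  move=> mM1 mY; apply/eqP; rewrite eqEcard subsetI sMC // mY CY2.
  by rewrite (edge_card eI) ?sME.
have nocross m : m \in M -> (m \subset X) || (m \subset Y).
  move=> mM1; apply: contraT; rewrite negb_or => /andP[nX nY].
  have [m' mM2 nmm] : exists2 m', m' \in M & m' != m.
    have : 0 < #|M :\ m| by have := cardsD1 m M; rewrite mM1 M2 add1n => -[<-].
    by case/card_gt0P => m'; rewrite !inE => /andP[? ?]; exists m'.
  have [x xm xX] : exists2 x, x \in m & x \in X.
    have /subsetPn[x xm xY] := nY; exists x => //.
    by have := subsetP sC _ (subsetP (sMC _ mM1) _ xm); rewrite inE (negbTE xY) orbF.
  have [y ym yY] : exists2 y, y \in m & y \in Y.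
    have /subsetPn[y ym yX] := nX; exists y => //.
    by have := subsetP sC _ (subsetP (sMC _ mM1) _ ym); rewrite inE (negbTE yX).
  have xC := subsetP (sMC _ mM1) _ xm; have yC := subsetP (sMC _ mM1) _ ym.
  case: (boolP (m' \subset X)) => [/(inX _ mM2) E|nX'].
    by move: nmm; rewrite (dM m' m x) ?eqxx // E inE xC.
  case: (boolP (m' \subset Y)) => [/(inY _ mM2) E|nY'].
    by move: nmm; rewrite (dM m' m y) ?eqxx // E inE yC.
  by rewrite (cross m' m) ?eqxx in nmm.
apply/eqP; rewrite eqEcard; apply/andP; split.
  apply/subsetP => m mM1; rewrite !inE.
  by case/orP: (nocross _ mM1) => [/(inX _ mM1)->|/(inY _ mM1)->]; rewrite eqxx ?orbT.
by rewrite M2 cards2; case: eqP.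
Qed.

Lemma triangle_inner A : triangle e A -> #|A| <= #|inner_edges e A|.
Proof.
case=> A3 cA; apply: card_inner_edges => // x xA.
have : #|A :\ x| = 2 by have := cardsD1 x A; rewrite xA A3 add1n => -[<-].
move/eqP/cards2P => [u [v [nuv E]]]; exists u, v.
have : u \in A :\ x by rewrite E !inE eqxx.
have : v \in A :\ x by rewrite E !inE eqxx orbT.
rewrite !inE => /andP[nv vA] /andP[nu uA].
by split=> //; apply: cA => //; rewrite eq_sym.
Qed.

(** The cycle has an uncovered vertex [x]; its two neighbours on the cycle must be covered, so they
    are the ends of the matching edge, which closes the triangle. *)
Lemma cover_cycle_triangle s M : is_graph_cycle e s -> M \in small_maximal e ->
  cover M :&: [set x in s] \in M -> #|cover M :&: [set x in s]| = 2 ->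
  exists A, [/\ triangle e A, A \subset [set x in s] & cover M :&: [set x in s] \subset A].
Proof.
move=> cs; rewrite !inE => /andP[/(maximal_matchingP eS)[mM cov] _] CM C2.
have [/subsetP sME _] := matchingP _ _ mM.
have [x xs xC] : exists2 x, x \in s & x \notin cover M.
  have : ~~ ([set x in s] \subset cover M).
    apply: contraTN (cycle_size cs) => /setIidPr E; by rewrite -E C2.
  by case/subsetPn => x; rewrite inE; exists x.
have [u [v [us vs nuv exu exv]]] := cycle_neighbours eS cs xs.
have uC : u \in cover M by have := cov _ _ exu; rewrite (negbTE xC).
have vC : v \in cover M by have := cov _ _ exv; rewrite (negbTE xC).
have CE : cover M :&: [set x in s] = [set u; v].
  apply/esym/eqP; rewrite eqEcard C2 cards2 nuv andbT.
  by apply/subsetP => z; rewrite !inE => /orP[]/eqP->; rewrite ?us ?vs ?uC ?vC.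
have euv : e u v by rewrite -in_edges // -CE sME.
exists (x |: [set u; v]); split; last by rewrite CE subsetUr.
  split; first by rewrite cardsU1 cards2 nuv !inE negb_or !(edge_neq eI).
  move=> a b; rewrite !inE => /or3P[]/eqP-> /or3P[]/eqP->; rewrite ?eqxx // => _ //.
  - by rewrite eS.
  - by rewrite eS.
  - by rewrite eS.
by apply/subsetP => z; rewrite !inE => /or3P[]/eqP->.
Qed.

(** Both edges of [M] extend to triangles by [cover_cycle_triangle]. Vertices outside them are
    uncovered, so no edge joins two of those. *)
Lemma small_maximal_triangles s1 s2 M :
  is_graph_cycle e s1 -> is_graph_cycle e s2 -> all (fun x => x \notin s2) s1 ->
  M \in small_maximal e ->
  exists A B, [/\ triangle e A, triangle e B, [disjoint A & B] &
    forall x y, x \notin A -> x \notin B -> y \notin A -> y \notin B -> ~~ e x y].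
Proof.
move=> c1 c2 /allP d12 sM.
have := sM; rewrite !inE => /andP[/(maximal_matchingP eS)[mM cov] _].
have dXY : [disjoint [set x in s1] & [set x in s2]].
  by rewrite disjoint_subset; apply/subsetP => x; rewrite !inE => /d12.
have cin s : is_graph_cycle e s -> #|[set x in s]| <= #|inner_edges e [set x in s]|.
  move=> cs; apply: card_inner_edges => // x; rewrite inE => xs.
  by have [u [v [us vs *]]] := cycle_neighbours eS cs xs; exists u, v; rewrite !inE.
have [ME sC C1 C2] := small_maximal_split dXY (cin _ c1) (cin _ c2) sM
  (vertex_cover_cycle eS eI c1 cov) (vertex_cover_cycle eS eI c2 cov).
have M1 := set21 (cover M :&: [set x in s1]) (cover M :&: [set x in s2]).
have M2 := set22 (cover M :&: [set x in s1]) (cover M :&: [set x in s2]).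
rewrite -ME in M1 M2.
have [A [tA sA CA]] := cover_cycle_triangle c1 sM M1 C1.
have [B [tB sB CB]] := cover_cycle_triangle c2 sM M2 C2.
exists A, B; split=> //; first exact: disjointWl sA (disjointWr sB dXY).
have out z : z \notin A -> z \notin B -> z \notin cover M.
  move=> zA zB; apply/negP => zC; move: (subsetP sC _ zC); rewrite inE => /orP[] zs.
    by move: zA; rewrite (subsetP CA) // inE zC.
  by move: zB; rewrite (subsetP CB) // inE zC.
move=> x y xA xB yA yB; apply/negP => /cov.
by rewrite (negbTE (out _ xA xB)) (negbTE (out _ yA yB)).
Qed.

End Bicyclic.

(** * Incompatible matchings built from two triangles *)

Section TriangleFamilies.
Variables (T : finType) (e : rel T).
Hypotheses (eS : symmetric e) (eI : irreflexive e).
Implicit Types (x y z u v r : T) (m X Y : {set T}) (M F : {set {set T}}).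

Lemma triangleD1 X u : triangle e X -> u \in X -> X :\ u \in edges e.
Proof.
case=> X3 cX uX; have : #|X :\ u| = 2 by have := cardsD1 u X; rewrite uX X3 add1n => -[<-].
move/eqP/cards2P => [x [y [nxy E]]]; rewrite E in_edges //.
have : x \in X :\ u by rewrite E set21.
have : y \in X :\ u by rewrite E set22.
by rewrite !inE => /andP[_ yX] /andP[_ xX]; apply: cX.
Qed.

(** A vertex cover cannot miss two adjacent vertices. *)
Lemma triangle_vertex_cover X (C : {set T}) : triangle e X ->
  (forall x y, e x y -> (x \in C) || (y \in C)) -> 1 < #|C :&: X|.
Proof.
case=> X3 cX cov; rewrite setIC; have := cardsID C X; rewrite X3.
case: (ltnP 1 #|X :\: C|); last by lia.
case/card_gt1P => x [y]; rewrite !inE => -[/andP[xC xX] /andP[yC yX] nxy].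
by have := cov _ _ (cX _ _ xX yX nxy); rewrite (negbTE xC) (negbTE yC).
Qed.

(* A bridge [pq] with [p] in [X] and [q] in [Y] is covered by the case [r = v = q]. *)
Definition hook X Y r u v := [set [set r; u]; X :\ u; Y :\ v].

Lemma hook_matching X Y r u v : triangle e X -> triangle e Y -> [disjoint X & Y] ->
  e r u -> u \in X -> v \in Y -> r \notin X -> r \notin Y :\ v ->
  matching e (hook X Y r u v) /\ 2 < #|hook X Y r u v|.
Proof.
move=> tX tY dXY eru uX vY rX rY; rewrite /hook.
set m1 := [set r; u]; set m2 := X :\ u; set m3 := Y :\ v.
have m1E : m1 \in edges e by rewrite in_edges.
have m2E : m2 \in edges e by apply: triangleD1.
have m3E : m3 \in edges e by apply: triangleD1.
have d12 z : z \in m1 -> z \in m2 -> False.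
  by rewrite !inE => /orP[]/eqP->; rewrite ?eqxx // (negbTE rX) andbF.
have d13 z : z \in m1 -> z \in m3 -> False.
  rewrite inE => /orP[]/set1P->; first by rewrite (negbTE rY).
  by rewrite !inE (disjointFr dXY uX) andbF.
have d23 z : z \in m2 -> z \in m3 -> False.
  by rewrite !inE => /andP[_ zX]; rewrite (disjointFr dXY zX) andbF.
have ne m m' : m \in edges e -> (forall z, z \in m -> z \in m' -> False) -> m != m'.
  move=> /edgesP[x [y [_ E]]] d; apply/eqP => Em.
  by apply: (d x); rewrite -?Em E !inE eqxx.
split.
  apply/matchingP; split.
    by apply/subsetP => m; rewrite !inE => /orP[/orP[]|]/eqP->.
  move=> a b z; rewrite !inE => /orP[/orP[]|]/eqP-> /orP[/orP[]|]/eqP-> // za zb; exfalso.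
  - exact: d12 za zb.
  - exact: d13 za zb.
  - exact: d12 zb za.
  - exact: d23 za zb.
  - exact: d13 zb za.
  - exact: d23 zb za.
rewrite -setUA cardsU1 cards2 !inE negb_or.
by rewrite (ne m1 m2) // (ne m1 m3) // (ne m2 m3).
Qed.

(** The two pairs share the third element of [X]. *)
Lemma triangleD1_meet X u u' : #|X| = 3 -> u \in X -> u' \in X -> u != u' ->
  X :\ u != X :\ u' /\ exists z, z \in X :\ u /\ z \in X :\ u'.
Proof.
move=> X3 uX uX' nu; split.
  by apply/eqP => /setP /(_ u); rewrite !inE eqxx uX nu.
have : 0 < #|X :\ u :\ u'|.
  have := cardsD1 u X; have := cardsD1 u' (X :\ u).
  by rewrite !inE uX uX' X3 eq_sym nu /= !add1n => -> [->].
by case/card_gt0P => z; rewrite !inE => /and3P[a b c]; exists z; rewrite !inE a b c.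
Qed.

(** A conflict arises in [X] if [u] and [u'] differ, in [Y] if [v] and [v'] differ, and otherwise at
    [u], which is joined to both [r] and [r']. *)
Lemma hook_incompatible X Y r u v r' u' v' : #|X| = 3 -> #|Y| = 3 ->
  u \in X -> u' \in X -> v \in Y -> v' \in Y -> r \notin X -> r' \notin X ->
  (r, u, v) != (r', u', v') -> incompatible (hook X Y r u v) (hook X Y r' u' v').
Proof.
move=> X3 Y3 uX uX' vY vY' rX rX' ne.
have [Eu|nu] := eqVneq u u'; last first.
  have [nX [z [zu zu']]] := triangleD1_meet X3 uX uX' nu.
  by exists (X :\ u), (X :\ u'), z; split; rewrite // /hook !inE eqxx ?orbT.
subst u'; have [Ev|nv] := eqVneq v v'; last first.
  have [nY [z [zu zu']]] := triangleD1_meet Y3 vY vY' nv.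
  by exists (Y :\ v), (Y :\ v'), z; split; rewrite // /hook !inE eqxx ?orbT.
subst v'; exists [set r; u], [set r'; u], u; split; rewrite ?inE ?eqxx ?orbT //.
apply/eqP => /setP /(_ r); rewrite !inE eqxx /= => /esym/orP[]/eqP E.
  by rewrite E eqxx in ne.
by rewrite E uX in rX.
Qed.

(** With the triangles exchanged, the conflict is between the edges [X :\ u] and [X :\ v']. *)
Lemma hook_incompatible_swap X Y r u v r' u' v' : #|X| = 3 ->
  u \in X -> v' \in X -> u != v' -> incompatible (hook X Y r u v) (hook Y X r' u' v').
Proof.
move=> X3 uX vX nu; have [nX [z [zu zu']]] := triangleD1_meet X3 uX vX nu.
by exists (X :\ u), (X :\ v'), z; split; rewrite // /hook !inE eqxx ?orbT.
Qed.

(** The pair [i = (r, v)] indexes the hook through [t r]; the membership and adjacency conditions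
    are those of [hook_matching]. *)
Definition hooked (t : T -> T) X Y (i : T * T) :=
  [&& t i.1 \in X, i.2 \in Y, i.1 \notin X, i.1 \notin Y :\ i.2 & e i.1 (t i.1)].

(** On one side, distinct indices already give incompatible hooks. Between the two sides, the
    hypothesis on [j.2] and [t i.1] makes the hooks leave out different vertices of [X]. *)
Lemma card_large_hooks X Y (I : {set T * T}) (t : T -> T) :
  triangle e X -> triangle e Y -> [disjoint X & Y] ->
  {in I, forall i, hooked t X Y i || hooked t Y X i} ->
  {in I &, forall i j, hooked t X Y i -> hooked t Y X j -> j.2 != t i.1} ->
  #|I| <= #|large_maximal e|.
Proof.
move=> tX tY dXY hI hIJ; have dYX : [disjoint Y & X] by rewrite disjoint_sym.
pose F i := if hooked t X Y i then hook X Y i.1 (t i.1) i.2 else hook Y X i.1 (t i.1) i.2.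
apply: (@card_large_ge _ _ _ _ F) => [i iI | i j iI jI nij]; rewrite /F.
  have := hI _ iI; case: ifP => /= [/and5P[a b c d f] _|_ /and5P[a b c d f]].
    exact: hook_matching.
  exact: hook_matching.
have nij' : (i.1, t i.1, i.2) != (j.1, t j.1, j.2).
  by apply: contraNneq nij => -[E _ E']; rewrite (surjective_pairing i) E E' -surjective_pairing.
have [X3 _] := tX; have [Y3 _] := tY.
have := hI _ iI; have := hI _ jI.
case: ifP => hi; case: ifP => hj /=.
- move=> _ _; have /and5P[a b c d f] := hi; have /and5P[a' b' c' d' f'] := hj.
  exact: hook_incompatible.
- move=> hj' _; have := hIJ _ _ iI jI hi hj'; rewrite eq_sym.
  have /and5P[a b c d f] := hi; have /and5P[a' b' c' d' f'] := hj'.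
  exact: hook_incompatible_swap.
- move=> _ hi'; have := hIJ _ _ jI iI hj hi'; rewrite eq_sym => n.
  have /and5P[a b c d f] := hi'; have /and5P[a' b' c' d' f'] := hj.
  by apply: incompatible_sym; apply: hook_incompatible_swap.
- move=> hj' hi'; have /and5P[a b c d f] := hi'; have /and5P[a' b' c' d' f'] := hj'.
  exact: hook_incompatible.
Qed.

End TriangleFamilies.

(** * Two triangles and an independent set *)

Section TwoTriangles.
Variables (T : finType) (e : rel T).
Hypotheses (eS : symmetric e) (eI : irreflexive e) (conn : connected_graph e).
Hypothesis cardE : #|edges e| = #|T|.+1.
Variables (A B : {set T}).
Hypotheses (tA : triangle e A) (tB : triangle e B) (dAB : [disjoint A & B]).
Hypothesis indep : forall x y, x \notin A -> x \notin B -> y \notin A -> y \notin B -> ~~ e x y.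
Variable t : T -> T.
Hypothesis ht : forall r, r \notin A -> r \notin B -> e r (t r) /\ (t r \in A) || (t r \in B).

Let R := ~: (A :|: B).
Let P := [set u | [exists r in R, e u r]].
(** An outside vertex may see both triangles; only its chosen neighbour decides the class. *)
Let RA := [set r in R | t r \in A].
Let RB := [set r in R | t r \in B].

Lemma outsideP r : reflect (r \notin A /\ r \notin B) (r \in R).
Proof. by rewrite !inE negb_or; apply: andP. Qed.

Lemma attachedP u : reflect (exists2 r, r \in R & e u r) (u \in P).
Proof. by rewrite inE; apply: exists_inP. Qed.

Lemma card_outside : #|T| = #|R| + 6.
Proof.
have [A3 _] := tA; have [B3 _] := tB.
rewrite addnC -(cardsC (A :|: B)) card_setU_disjoint ?A3 ?B3 // => x xA.
by rewrite (disjointFr dAB xA).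
Qed.

Lemma card_outside_split : #|R| = #|RA| + #|RB|.
Proof.
rewrite -card_setU_disjoint; last first.
  by move=> r; rewrite !inE => /andP[_ trA]; rewrite (disjointFr dAB trA) andbF.
apply: eq_card => r; apply/idP/setUP => [rR|[]/setIdP[] //].
have [rA rB] := outsideP _ rR.
by have [_ /orP[] h] := ht rA rB; [left|right]; apply/setIdP.
Qed.

(** By [small_maximal_split], [M] misses one vertex [a] of [A], one vertex [b] of [B] and all of
    [R]. Missed vertices are pairwise nonadjacent. *)
Lemma small_maximal_form M : M \in small_maximal e ->
  exists a b, [/\ a \in A :\: P, b \in B :\: P, ~~ e a b & M = [set A :\ a; B :\ b]].
Proof.
move=> sM; have := sM; rewrite !inE => /andP[/(maximal_matchingP eS)[mM cov] _].
have [ME sC CA CB] := small_maximal_split eS eI conn cardE dAB (triangle_inner eS eI tA)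
  (triangle_inner eS eI tB) sM (triangle_vertex_cover tA cov) (triangle_vertex_cover tB cov).
have miss X : triangle e X -> #|cover M :&: X| = 2 ->
    exists a, [/\ a \in X, a \notin cover M & cover M :&: X = X :\ a].
  case=> X3 _ CX; have : #|X :\: cover M| = 1 by have := cardsID (cover M) X; rewrite setIC; lia.
  move/eqP/cards1P => [a E]; exists a.
  have : a \in X :\: cover M by rewrite E set11.
  rewrite inE => /andP[aC aX]; split=> //; apply/setP => z.
  by have /setP/(_ z) := E; rewrite !inE => <-; case: (z \in X); case: (z \in cover M).
have [a [aA aC EA]] := miss _ tA CA; have [b [bB bC EB]] := miss _ tB CB.
have nP z : z \notin cover M -> z \notin P.
  move=> zC; apply/attachedP => -[r /outsideP[rA rB] ezr].
  have := cov _ _ ezr; rewrite (negbTE zC) /= => /(subsetP sC).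
  by rewrite inE (negbTE rA) (negbTE rB).
exists a, b; rewrite !(in_setD, aA, bB, nP) //; split=> //; last by rewrite {1}ME EA EB.
by apply/negP => /cov; rewrite (negbTE aC) (negbTE bC).
Qed.

Lemma card_small_le :
  #|small_maximal e| <= #|[set p in setX (A :\: P) (B :\: P) | ~~ e p.1 p.2]|.
Proof.
pose f (p : T * T) := [set A :\ p.1; B :\ p.2].
apply: leq_trans (leq_imset_card f _); apply/subset_leq_card/subsetP => M.
case/small_maximal_form => a [b [aA bB nab ->]]; apply/imsetP; exists (a, b) => //.
by rewrite inE in_setX /= aA bB.
Qed.

Lemma card_small_leM : #|small_maximal e| <= #|A :\: P| * #|B :\: P|.
Proof.
rewrite -cardsX; apply: leq_trans card_small_le _; apply/subset_leq_card/subsetP => p.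
by rewrite inE => /andP[].
Qed.

(** * Lower bounds for the number of larger maximal matchings *)

Lemma hookedA r v : r \in RA -> v \in B -> hooked e t A B (r, v).
Proof.
rewrite inE => /andP[/outsideP[rA rB] trA] vB.
by rewrite /hooked /= trA vB rA inE negb_and rB orbT; have [] := ht rA rB.
Qed.

Lemma hookedB r v : r \in RB -> v \in A -> hooked e t B A (r, v).
Proof.
rewrite inE => /andP[/outsideP[rA rB] trB] vA.
by rewrite /hooked /= trB vA rB inE negb_and rA orbT; have [] := ht rA rB.
Qed.

Lemma hookedF i : hooked e t A B i -> hooked e t B A i -> False.
Proof. by case/andP => ta _ /andP[]; rewrite (disjointFr dAB ta). Qed.

(** Only hooks on [A] are taken, with [v] running over the three vertices of [B]. *)
Lemma card_large_RA : #|RA| * 3 <= #|large_maximal e|.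
Proof.
have [B3 _] := tB; rewrite -B3 -cardsX.
have hI i : i \in setX RA B -> hooked e t A B i by case: i => r v /setXP[]; apply: hookedA.
apply: (card_large_hooks (I := setX RA B) eS (t := t) tA tB dAB) => [i /hI -> //|i j iI jI _].
by move/(hookedF (hI _ jI)).
Qed.

(** A hook on [B] may leave out either vertex of [A :\ a1]. Leaving out [a1] is avoided, since all
    hooks on [A] leave it out too and the two kinds need not conflict. *)
Lemma card_large_RA_RB a1 : a1 \in A -> (forall r, r \in RA -> t r = a1) ->
  #|RA| * 3 + #|RB| * 2 <= #|large_maximal e|.
Proof.
move=> a1A ta; have [A3 _] := tA; have [B3 _] := tB.
have A2 : #|A :\ a1| = 2 by have := cardsD1 a1 A; rewrite a1A A3 add1n => -[<-].
rewrite -{1}B3 -A2 -!cardsX -card_setU_disjoint; last first.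
  move=> [r v] /setXP[rRA vB]; rewrite !inE /= ; move: rRA; rewrite inE => /andP[_ trA].
  by rewrite (disjointFr dAB trA) !andbF.
have hI r v : (r, v) \in setX RA B :|: setX RB (A :\ a1) ->
    (r \in RA /\ hooked e t A B (r, v)) \/ (v != a1 /\ hooked e t B A (r, v)).
  rewrite inE => /orP[]/setXP[rR vB]; first by left; split=> //; apply: hookedA.
  by move: vB; rewrite !inE => /andP[nv vA]; right; split=> //; apply: hookedB.
apply: (card_large_hooks (I := setX RA B :|: setX RB (A :\ a1)) eS (t := t) tA tB dAB).
  by case=> r v /hI[][_ ->]; rewrite ?orbT.
case=> r v [r' v'] /hI[[rR _]|[_ h1]] /hI[[_ h2]|[nv _]] hA hB /=; try by case: (hookedF hA).
- by case: (hookedF h2).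
- by rewrite ta.
Qed.

(** The bridge contributes the hook with [r = v = q], hence the extra index [(q, q)]. *)
Lemma card_large_bridge p q : p \in A -> q \in B -> e p q ->
  #|RA| * 3 + 1 <= #|large_maximal e|.
Proof.
move=> pA qB epq; have [B3 _] := tB; rewrite -B3 -cardsX.
have qR : q \notin RA by rewrite !inE qB orbT.
have <- : #|(q, q) |: setX RA B| = #|setX RA B| + 1.
  by rewrite cardsU1 in_setX (negbTE qR) addnC.
(* Redirecting [q] to [p] changes no hook indexed by [RA], as [q] is in [B]. *)
pose t' r := if r == q then p else t r.
have hI i : i \in (q, q) |: setX RA B -> hooked e t' A B i.
  rewrite in_setU1 => /orP[/eqP->|].
    by rewrite /hooked /t' /= eqxx pA qB !inE eqxx (disjointFl dAB qB) eS.
  case: i => r v /setXP[rR vB]; have := hookedA rR vB; rewrite /hooked /t' /=.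
  by case: eqP => // rq; rewrite rq (negbTE qR) in rR.
apply: (card_large_hooks (I := (q, q) |: setX RA B) eS (t := t') tA tB dAB) => [i /hI -> //|i j iI jI _].
by case/andP=> tj _; have /andP[tj' _] := hI _ jI; rewrite (disjointFr dAB tj') in tj.
Qed.

(** * The bridge and the recognition of the extremal graph *)

(** An edge between [A] and [B] lies in neither triangle and is no edge [{r, t r}], so
    [extra_edge_unique] applies. *)
Lemma bridge_unique a b p q : a \in A -> b \in B -> e a b ->
  p \in A -> q \in B -> e p q -> a = p /\ b = q.
Proof.
move=> aA bB eab pA qB epq.
have ok x y : x \in A -> y \in B -> e x y ->
    [/\ [set x; y] \in edges e, ~~ ([set x; y] \subset A), ~~ ([set x; y] \subset B) &
     forall r, r \notin A -> r \notin B -> [set x; y] != [set r; t r]].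
  move=> xA yB exy; split; rewrite ?in_edges //.
  - by apply/subsetPn; exists y; rewrite ?set22 // (disjointFl dAB yB).
  - by apply/subsetPn; exists x; rewrite ?set21 // (disjointFr dAB xA).
  - move=> r rA rB; apply/eqP => /setP/(_ r); rewrite !inE eqxx => /orP[]/eqP E.
      by rewrite E xA in rA.
    by rewrite E yB in rB.
have /setP E : [set a; b] = [set p; q].
  apply: (extra_edge_unique eS eI cardE (t := t) dAB (triangle_inner eS eI tA) (triangle_inner eS eI tB)).
    by move=> r rA rB; have [] := ht rA rB; rewrite inE.
  by move=> m; rewrite !inE => /orP[]/eqP->; apply: ok.
have := E a; have := E b; rewrite !inE !eqxx orbT /= => /esym/orP[]/eqP Eb /esym/orP[]/eqP Ea //.
- by rewrite -Eb (disjointFl dAB bB) in pA.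
- by rewrite -Eb (disjointFl dAB bB) in pA.
- by rewrite Ea (disjointFl dAB qB) in aA.
Qed.

(** With no edge to [A] and no outside neighbours, [B] would be closed under adjacency, against
    connectivity. *)
Lemma bridge_exists : (forall b, b \in B -> b \notin P) ->
  exists p q, [/\ p \in A, q \in B & e p q].
Proof.
move=> BP; have [A3 _] := tA; have [B3 _] := tB.
have [a aA] : exists a, a \in A by apply/card_gt0P; rewrite A3.
have [b bB] : exists b, b \in B by apply/card_gt0P; rewrite B3.
case: (boolP [exists p in A, exists q in B, e p q]) => [|/exists_inPn H].
  by case/exists_inP => p pA /exists_inP[q qB epq]; exists p, q.
have cl : closed e B.
  apply: intro_closed => [|x y exy xB]; first exact: sym_connect_sym.
  apply: contraT => yB; case: (boolP (y \in A)) => yA.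
    by have /exists_inPn/(_ x xB) := H _ yA; rewrite eS exy.
  case/negP: (BP _ xB); apply/attachedP; exists y => //; exact/outsideP.
by have := closed_connect cl (conn b a); rewrite bB (disjointFr dAB aA).
Qed.

(** Every outside vertex is adjacent to [p] and to nothing else, and [pq] is the only edge between
    the triangles; this determines all adjacencies. *)
Lemma iso_Tn133 p q : p \in A -> q \in B -> e p q ->
  (forall a, a \in A -> a \in P -> a = p) -> (forall b, b \in B -> b \notin P) ->
  graph_iso e (Tn133 #|T|).
Proof.
move=> pA qB epq AP BP; have [A3 cA] := tA; have [B3 cB] := tB.
have rest (X : {set T}) x : #|X| = 3 -> x \in X -> exists y z, [/\ y != z, y \in X, z \in X, x != y & x != z]
    /\ forall w, w \in X -> [\/ w = x, w = y | w = z].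
  move=> X3 xX; have : #|X :\ x| = 2 by have := cardsD1 x X; rewrite xX X3 add1n => -[<-].
  move/eqP/cards2P => [y [z [nyz /setP E]]]; exists y, z.
  have := E y; have := E z; rewrite !inE !eqxx orbT /= => /andP[nz zX] /andP[ny yX].
  split; first by split=> //; rewrite eq_sym.
  move=> w wX; have := E w; rewrite !inE wX andbT; case: (eqVneq w x) => [->|_]; first by constructor.
  by move=> /esym/orP[]/eqP->; constructor.
have [x2 [x3 [[n23 x2A x3A np2 np3] AE]]] := rest _ _ A3 pA.
have [y2 [y3 [[m23 y2B y3B nq2 nq3] BE]]] := rest _ _ B3 qB.
have AB x y : x \in A -> y \in B -> (x == y) = false.
  by move=> xA yB; apply: contraTF yB => /eqP <-; rewrite (disjointFr dAB xA).
have RX r x : r \in R -> x \in A :|: B -> (x == r) = false.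
  by move=> rR xU; apply: contraTF rR => /eqP <-; rewrite inE xU.
(* The position in [l] is the label of the vertex in [Tn133]. *)
pose l := [:: x2; x3; p; q; y2; y3] ++ enum R.
have idxR r : r \in R -> exists j, index r l = 6 + j.
  move=> rR; exists (index r (enum R)); rewrite /l index_cat ifN //=.
  rewrite !inE ![r == _]eq_sym !(RX r) // inE ?pA ?qB ?x2A ?x3A ?y2B ?y3B ?orbT //.
have i2 : index x2 l = 0 by rewrite /= eqxx.
have i3 : index x3 l = 1 by rewrite /= eqxx (negbTE n23).
have ip : index p l = 2 by rewrite /= eqxx ![_ == p]eq_sym (negbTE np2) (negbTE np3).
have iq : index q l = 3 by rewrite /= eqxx !AB.
have j2 : index y2 l = 4 by rewrite /= eqxx (AB x2) // (AB x3) // (AB p) // ?(negbTE nq2).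
have j3 : index y3 l = 5 by rewrite /= eqxx (AB x2) // (AB x3) // (AB p) // ?(negbTE nq3) ?(negbTE m23).
have cases x : [\/ x = x2 \/ x = x3, x = p \/ x = q, x = y2 \/ x = y3 | x \in R].
  case: (boolP (x \in A)) => [/AE[]->|xA]; [constructor 2 | constructor 1 | constructor 1 |]; auto.
  case: (boolP (x \in B)) => [/BE[]->|xB]; [constructor 2 | constructor 3 | constructor 3 |]; auto.
  by constructor 4; apply/outsideP.
have lP x : index x l < #|T|.
  have sl : size l = #|T| by rewrite size_cat -fintype.cardE card_outside addnC.
  rewrite -sl index_mem mem_cat mem_enum.
  by case: (cases x) => [[]->|[]->|[]->|->]; rewrite ?orbT // !inE !eqxx ?orbT.
have eA x y : x \in A -> y \in A -> e x y = (x != y).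
  by move=> xA yA; case: eqVneq => [->|n]; [rewrite eI | apply: cA].
have eB x y : x \in B -> y \in B -> e x y = (x != y).
  by move=> xA yA; case: eqVneq => [->|n]; [rewrite eI | apply: cB].
have eAB x y : x \in A -> y \in B -> e x y = (x == p) && (y == q).
  move=> xA yB; apply/idP/andP => [exy|[/eqP-> /eqP-> //]].
  by have [-> ->] := bridge_unique xA yB exy pA qB epq.
have eBA x y : x \in B -> y \in A -> e x y = (y == p) && (x == q).
  by move=> xB yA; rewrite eS eAB.
(* The chosen neighbour of [r] is an attached vertex, and [p] is the only one in the triangles. *)
have tR r : r \in R -> t r = p.
  move=> rR; have [rA rB] := outsideP _ rR; have [er] := ht rA rB.
  have tP : t r \in P by apply/attachedP; exists r => //; rewrite eS.
  case/orP => [/AP/(_ tP) //|tB']; by case/negP: (BP _ tB').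
have eR x r : r \in R -> e x r = (x == p).
  move=> rR; have [rA rB] := outsideP _ rR; apply/idP/eqP => [exr|->]; last first.
    by rewrite eS -(tR _ rR); have [] := ht rA rB.
  have xP : x \in P by apply/attachedP; exists r.
  case: (boolP (x \in A)) => [xA|xA]; first exact: AP.
  case: (boolP (x \in B)) => [xB|xB]; first by case/negP: (BP _ xB).
  by have := indep xA xB rA rB; rewrite exr.
have eR' x r : r \in R -> e r x = (x == p) by move=> rR; rewrite eS eR.
have pq x : x \in R -> (x == p) = false by move=> xR; rewrite eq_sym (RX x) // inE pA.
exists (fun x => Ordinal (lP x)); split.
  apply: inj_card_bij; last by rewrite card_ord.
  move=> x y /(congr1 val) Exy; have E : index x l = index y l := Exy.
  have ins z : z \in l by rewrite -index_mem size_cat -fintype.cardE [_ + _]addnC -card_outside lP.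
  by rewrite -(nth_index x (ins x)) E nth_index.
(* Equalities between named vertices, oriented so that rewriting evaluates the cases of the final
   comparison. *)
have sA := (eqxx, negbTE n23, negbTE np2, negbTE np3, eq_sym x3 x2, eq_sym x2 p, eq_sym x3 p).
have sB := (negbTE m23, negbTE nq2, negbTE nq3, eq_sym y3 y2, eq_sym y2 q, eq_sym y3 q).
have sP := (AB _ _ pA qB, AB _ _ pA y2B, AB _ _ pA y3B, eq_sym q p, eq_sym y2 p, eq_sym y3 p).
move=> x y; change (T1_adj (index x l) (index y l) || T1_adj (index y l) (index x l) = e x y).
have [[->|->]|[->|->]|[->|->]|xR] := cases x; have [[->|->]|[->|->]|[->|->]|yR] := cases y;
  rewrite ?(i2, i3, ip, iq, j2, j3);
  try (have [j ->] := idxR _ xR); try (have [j' ->] := idxR _ yR);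
  first [rewrite eA; [|by []|by []] | rewrite eB; [|by []|by []] | rewrite eAB; [|by []|by []]
    | rewrite eBA; [|by []|by []] | rewrite (eR _ _ yR) | rewrite (eR' _ _ xR)];
  rewrite ?sA ?sB ?sP ?pq //.
Qed.

(** * Comparison of the numbers of small and large maximal matchings *)

Lemma attached_t r : r \in R -> t r \in P.
Proof.
move=> rR; have [rA rB] := outsideP _ rR; have [er _] := ht rA rB.
by apply/attachedP; exists r => //; rewrite eS.
Qed.

Lemma card_detached (X : {set T}) u : #|X| = 3 -> u \in X -> u \in P -> #|X :\: P| <= 2.
Proof.
move=> X3 uX uP; have := cardsID P X; rewrite X3.
suff : 0 < #|X :&: P| by lia.
by apply/card_gt0P; exists u; rewrite inE uX.
Qed.

Lemma attached_unique (X : {set T}) u v : #|X| = 3 -> #|X :\: P| = 2 ->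
  u \in X -> u \in P -> v \in X -> v \in P -> u = v.
Proof.
move=> X3 XP uX uP vX vP; have := cardsID P X; rewrite X3 XP => XP1.
have /eqP/cards1P[w E] : #|X :&: P| = 1 by lia.
have : u \in X :&: P by rewrite inE uX.
have : v \in X :&: P by rewrite inE vX.
by rewrite E !inE => /eqP-> /eqP->.
Qed.

(** Write [k = #|R|]. Some vertex of [A] is attached to the outside; the cases are whether [B] has
    attached vertices too, and how many vertices of each triangle stay detached. *)
Lemma small_lt_large : 0 < #|R| -> #|RB| <= #|RA| -> ~ graph_iso e (Tn133 #|T|) ->
  #|small_maximal e| * (3 * (#|T| - 6) + 1) < 6 * #|large_maximal e|.
Proof.
move=> R0 leR niso; have [A3 _] := tA; have [B3 _] := tB.
have Rsplit := card_outside_split; rewrite card_outside addnK.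
have bound c : #|small_maximal e| <= c ->
    #|small_maximal e| * (3 * #|R| + 1) <= c * (3 * #|R| + 1) by move=> ?; rewrite leq_mul2r; apply/orP; right.
have [r rRA] : exists r, r \in RA by apply/card_gt0P; lia.
have /setIdP[rR trA] := rRA.
have sa := card_detached A3 trA (attached_t rR).
have le := card_small_leM.
have [/exists_inP[b bB bP]|/exists_inPn BP] := boolP [exists b in B, b \in P].
  have sb := card_detached B3 bB bP.
  case: (eqVneq #|A :\: P| 2) => [a2|na2].
    case: (eqVneq #|B :\: P| 2) => [b2|nb2].
      have large := @card_large_RA_RB (t r) trA.
      have {large} : #|RA| * 3 + #|RB| * 2 <= #|large_maximal e|.
        apply: large => r' /setIdP[rR' trA'].
        by apply: (attached_unique A3 a2) => //; apply: attached_t.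
      (* The claim [4 (3k + 1) < 6 (3 #|RA| + 2 #|RB|)] reduces to [4 < 6 #|RA|]. *)
      have := bound 4; rewrite a2 b2 in le; move=> /(_ le); lia.
    (* Here [2 (3k + 1) <= 12 #|RA| + 2 < 18 #|RA|], because [#|RB| <= #|RA|]. *)
    have : #|small_maximal e| <= 2 by apply: leq_trans le _; rewrite a2; lia.
    by move/bound; have := card_large_RA; lia.
  have : #|small_maximal e| <= 2 by apply: leq_trans le _; apply: (@leq_mul _ _ 1 2); lia.
  by move/bound; have := card_large_RA; lia.
(* No outside vertex sees [B]: then [RB] is empty and the bridge raises the bound on large matchings
   to [3k + 1], so it suffices to have at most five small ones. *)
have [p [q [pA qB epq]]] := bridge_exists BP.
have large := card_large_bridge pA qB epq.
have RB0 : #|RB| = 0.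
  apply: eq_card0 => x; apply/negP => /setIdP[xR txB].
  by case/negP: (BP _ txB); apply: attached_t.
case: (eqVneq #|A :\: P| 2) => [a2|na2]; last first.
  have : #|small_maximal e| <= 3.
    apply: leq_trans le _; apply: (@leq_mul _ _ 1 3); first by lia.
    by rewrite -B3 subset_leq_card ?subsetDl.
  by move/bound; lia.
(* If the only attached vertex of [A] is the bridge end [p], the graph is extremal. *)
have [pP|pP] := boolP (p \in P).
  case: niso; apply: (iso_Tn133 pA qB epq) => // a aA aP.
  exact: (attached_unique A3 a2).
(* Of at most six pairs, [(p, q)] is excluded because [p] and [q] are adjacent. *)
have : #|small_maximal e| <= 5.
  apply: leq_trans card_small_le _.
  have : #|setX (A :\: P) (B :\: P) :\ (p, q)| <= 5.
    have := cardsD1 (p, q) (setX (A :\: P) (B :\: P)).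
    rewrite in_setX !in_setD pA qB pP (BP _ qB) cardsX a2 /= add1n => E.
    have : #|B :\: P| <= 3 by rewrite -B3 subset_leq_card ?subsetDl.
    lia.
  apply: leq_trans; apply/subset_leq_card/subsetP => x.
  rewrite inE => /andP[xX nx]; rewrite in_setD1 xX andbT.
  by apply: contraNneq nx => ->.
by move/bound; lia.
Qed.

End TwoTriangles.

(** * The extremal graph and the comparison of averages *)

Section Extremal.
Variable n : nat.
Hypothesis n7 : 7 <= n.
Let e := Tn133 n.
Implicit Types (x y i w j : 'I_n) (m : {set 'I_n}) (M : {set {set 'I_n}}).

Lemma Tn133_sym : symmetric e.
Proof. by move=> x y; rewrite /e /Tn133 orbC. Qed.

Lemma Tn133_irr : irreflexive e.
Proof. by case=> [[|[|[|[|[|[|x]]]]]] hx]. Qed.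

(** Deleting the vertex 2 leaves the edge 01, the triangle 345 and isolated leaves. *)
Lemma Tn133_cases x y : e x y ->
  [|| (x == 2 :> nat), (y == 2 :> nat), [&& x < 2, y < 2 & x != y :> nat]
    | [&& 2 < x < 6, 2 < y < 6 & x != y :> nat]].
Proof. by case: x => [[|[|[|[|[|[|x]]]]]] hx]; case: y => [[|[|[|[|[|[|y]]]]]] hy]. Qed.

(** Labels start at 0: [v2] is the vertex carrying the leaves, and the bridge is [v2 v3]. *)
Let vtx k (k7 : k < 7) : 'I_n := Ordinal (leq_trans k7 n7).
Let v0 := vtx (isT : 0 < 7).
Let v1 := vtx (isT : 1 < 7).
Let v2 := vtx (isT : 2 < 7).
Let v3 := vtx (isT : 3 < 7).
Let v4 := vtx (isT : 4 < 7).
Let v5 := vtx (isT : 5 < 7).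
Let V := [set v0; v1; v2].
Let W := [set v3; v4; v5].

Lemma inV x : (x \in V) = (x < 3).
Proof. by rewrite !inE -!val_eqE /=; lia. Qed.

Lemma inW x : (x \in W) = (2 < x < 6).
Proof. by rewrite !inE -!val_eqE /=; lia. Qed.

Lemma triangleV : triangle e V.
Proof.
split; first by rewrite /V -setUA cardsU1 cards2 !inE -!val_eqE.
by case=> [[|[|[|x]]] hx] [[|[|[|y]]] hy]; rewrite !inV.
Qed.

Lemma triangleW : triangle e W.
Proof.
split; first by rewrite /W -setUA cardsU1 cards2 !inE -!val_eqE.
by case=> [[|[|[|[|[|[|x]]]]]] hx] [[|[|[|[|[|[|y]]]]]] hy]; rewrite !inW.
Qed.

Lemma disjointVW : [disjoint V & W].
Proof.
rewrite disjoint_subset; apply/subsetP => x xV; change (x \notin W); move: xV.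
by rewrite inV inW; lia.
Qed.

Lemma card_pendant : #|[set j : 'I_n | 5 < j]| = n - 6.
Proof.
have := cardsC [set j : 'I_n | 5 < j]; rewrite card_ord.
suff -> : #|~: [set j : 'I_n | 5 < j]| = 6 by lia.
have -> : ~: [set j : 'I_n | 5 < j] = V :|: W.
  by apply/setP => x; rewrite in_setC in_set in_setU inV inW; lia.
have [V3 _] := triangleV; have [W3 _] := triangleW.
by rewrite card_setU_disjoint ?V3 ?W3 // => x xV; rewrite (disjointFr disjointVW xV).
Qed.

Lemma Tn133_edge m : m \in edges e -> [\/ v2 \in m, m = [set v0; v1] | m \subset W].
Proof.
case/edgesP => x [y [exy ->]].
have H := Tn133_cases exy.
have [x2|nx2] := eqVneq (x : nat) 2.
  by constructor 1; rewrite !inE -!val_eqE /= x2.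
have [y2|ny2] := eqVneq (y : nat) 2.
  by constructor 1; rewrite !inE -!val_eqE /= y2 orbT.
have [x6|x6] := leqP 3 x.
  constructor 3; apply/subsetP => z; rewrite in_set2 inW => /orP[]/eqP->; lia.
constructor 2; apply/setP => z; rewrite !inE -!val_eqE /=; lia.
Qed.

(** The edges fall into three classes by [Tn133_edge], each containing at most one edge of [M]. A
    matching of size 3 uses all three; if its edge at [v2] is the bridge, its edge in [W] must avoid
    [v3]. *)
Lemma Tn133_matching3 M : matching e M -> [/\ #|M| <= 3 & #|M| = 3 ->
  exists j w, [/\ M = [set [set v2; j]; [set v0; v1]; W :\ w],
                  w \in W & (5 < j) || ((j == v3) && (w == v3))]].
Proof.
move=> mM; have [/subsetP sME dM] := matchingP _ _ mM.
pose C1 := [set m in M | v2 \in m].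
pose C2 := [set m in M | m == [set v0; v1]].
pose C3 := [set m in M | m \subset W].
have [W3 cW] := triangleW.
have c1 : #|C1| <= 1.
  by apply/card_le1_eqP => a b; rewrite !inE => /andP[aM a2] /andP[bM b2]; apply: (dM b a v2).
have c2 : #|C2| <= 1.
  by apply/card_le1_eqP => a b; rewrite !inE => /andP[_ /eqP->] /andP[_ /eqP->].
have card2 a : a \in M -> #|a| = 2 by move/sME; apply: edge_card; apply: Tn133_irr.
(* Two disjoint edges would need four vertices of [W]. *)
have c3 : #|C3| <= 1.
  apply/card_le1_eqP => a b; rewrite !inE => /andP[aM aW] /andP[bM bW].
  apply/eqP; apply: contraT => nab.
  have cab : #|a :|: b| = #|a| + #|b|.
    apply: card_setU_disjoint => z za; apply: contra nab => zb.
    by apply/eqP; apply: (dM b a z).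
  have : #|a :|: b| <= #|W| by rewrite subset_leq_card // subUset aW.
  by rewrite cab W3 (card2 a) // (card2 b).
have ME : M = C1 :|: C2 :|: C3.
  apply/setP => m; rewrite !inE; case: (boolP (m \in M)) => //= mM'.
  by case: (Tn133_edge (sME _ mM')) => [->|->|->]; rewrite ?eqxx ?orbT.
have le1 : #|M| <= #|C1 :|: C2| + #|C3| by rewrite {1}ME leq_card_setU.
have le2 : #|C1 :|: C2| <= #|C1| + #|C2| by rewrite leq_card_setU.
split; first by lia.
move=> M3.
have [p1 p2 p3] : [/\ 0 < #|C1|, 0 < #|C2| & 0 < #|C3|].
  move: c1 c2 c3 le1 le2; rewrite M3.
  by move: #|C1| #|C2| #|C3| #|C1 :|: C2| => a b c d; split; lia.
have [m1] := card_gt0P p1; have [m2] := card_gt0P p2; have [m3] := card_gt0P p3.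
rewrite !inE => /andP[m3M m3W] /andP[m2M /eqP E2] /andP[m1M m12]; rewrite E2 in m2M.
have nm2 : v2 \notin [set v0; v1] by rewrite !inE -!val_eqE.
have [j E1 e2j] : exists2 j, m1 = [set v2; j] & e v2 j.
  have /edgesP[x [y [exy E]]] := sME _ m1M; move: m12; rewrite E !inE => /orP[]/eqP Ev.
    by exists y; rewrite Ev.
  by exists x; rewrite Ev 1?setUC // Tn133_sym.
have jm1 : j \in m1 by rewrite E1 set22.
have j01 : j \notin [set v0; v1].
  by apply: contra nm2 => j01; rewrite -(dM m1 [set v0; v1] j).
have [w Ew] : exists w, W :\: m3 = [set w].
  by apply/cards1P; have := cardsID m3 W; rewrite (setIidPr m3W) W3 (card2 m3) // add2n => -[->].
have wW : (w \in W) && (w \notin m3).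
  by have : w \in W :\: m3; [rewrite Ew set11 | rewrite inE andbC].
have E3 : m3 = W :\ w.
  apply/setP => z; have /setP/(_ z) := Ew; rewrite !in_setD !in_set1.
  case: (boolP (z \in m3)) => [zm|_] /= <-; last by case: (z \in W).
  by rewrite (subsetP m3W).
exists j, w; split; last 2 first.
- by case/andP: wW.
- have j3 : (j : nat) = 3 -> w == v3.
    move=> j3; have jv : j = v3 by apply: val_inj.
    have v3m : v3 \notin m3.
      apply/negP => v3m; have E13 : m1 = m3 by apply: (dM m1 m3 j) => //; rewrite jv.
      by move: m12; rewrite E13 E3 => /setD1P[_]; rewrite inW.
    by have /setP/(_ v3) := Ew; rewrite !in_setD !in_set1 v3m inW eq_sym /= => <-.
  have e2j' : [|| j < 2, j == 3 :> nat | 5 < j].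
    by move: e2j; case: (j) => [[|[|[|[|[|[|j']]]]]] hj].
  case/or3P: e2j' => [j2|j3'|-> //].
    by case/negP: j01; rewrite !inE -!val_eqE /=; case: (nat_of_ord j) j2 => [|[]].
  by rewrite j3 ?(eqP j3') // andbT; apply/orP; right.
- rewrite -E1 -E3; apply/setP => m; apply/idP/idP => [mM'|].
    have := mM'; rewrite {1}ME => /setUP[/setUP[]|] mC.
    + by rewrite (card_le1_eqP c1 m m1) // !inE ?m1M ?eqxx.
    + by move: mC; rewrite !inE => /andP[_ ->]; rewrite orbT.
    + by rewrite (card_le1_eqP c3 m m3) // !inE ?m3M ?eqxx ?orbT.
  by rewrite !inE => /orP[/orP[]|]/eqP->.
Qed.

(** There are three choices of [w] for each of the [n - 6] leaves, and a single one for the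
    bridge. *)
Lemma card_large_Tn133 : #|large_maximal e| <= 3 * (n - 6) + 1.
Proof.
have [W3 _] := triangleW.
pose J := (v3, v3) |: setX [set j : 'I_n | 5 < j] W.
pose h (p : 'I_n * 'I_n) := [set [set v2; p.1]; [set v0; v1]; W :\ p.2].
have cJ : #|J| <= 3 * (n - 6) + 1.
  by rewrite cardsU1 cardsX card_pendant W3; case: (_ \notin _); lia.
apply: leq_trans cJ; apply: leq_trans (leq_imset_card h _).
apply/subset_leq_card/subsetP => M; rewrite !inE => /andP[/andP[mM _] M3].
have [le3 eq3] := Tn133_matching3 mM.
have [j [w [-> wW jw]]] : exists j w, [/\ M = [set [set v2; j]; [set v0; v1]; W :\ w],
    w \in W & (5 < j) || ((j == v3) && (w == v3))] by apply: eq3; apply/eqP; rewrite eqn_leq le3.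
apply/imsetP; exists (j, w) => //; rewrite in_setU1 in_setX wW andbT inE /=.
by case/orP: jw => [->|/andP[/eqP-> /eqP->]]; rewrite ?eqxx ?orbT.
Qed.

(** Leaving out [v0] or [v1] keeps [v2] covered, so with any vertex of [W] left out the two
    remaining pairs form a maximal matching. *)
Lemma card_small_Tn133 : 6 <= #|small_maximal e|.
Proof.
have [W3 _] := triangleW.
pose h (p : 'I_n * 'I_n) := [set V :\ p.1; W :\ p.2].
pose J := setX [set v0; v1] W.
have JP i w : (i, w) \in J -> [/\ i < 2, i \in V, w \in W & v2 \in V :\ i].
  case/setXP => iV wW; have i2 : i < 2 by move: iV; rewrite !inE -!val_eqE /=; lia.
  by rewrite in_setD1 !inV -val_eqE /= wW; split=> //; lia.
have nVW i i' w w' : (i, w) \in J -> V :\ i != W :\ w'.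
  case/JP => _ _ _ v2i; apply/eqP => /setP/(_ v2).
  by rewrite v2i in_setD1 inW /= andbF.
have cJ : #|J| = 6 by rewrite cardsX W3 cards2 -val_eqE.
have injD (X : {set 'I_n}) x y : x \in X -> X :\ x = X :\ y -> x = y.
  by move=> xX /setP/(_ x); rewrite !in_setD1 eqxx xX andbT /=; case: eqP.
rewrite -cJ -(card_in_imset (f := h)); last first.
  move=> [i w] [i' w'] hi hi' /setP E.
  have [_ iV wW _] := JP _ _ hi.
  have := E (V :\ i); have := E (W :\ w); rewrite /h !in_set2 /= !eqxx orbT /=.
  rewrite (negbTE (nVW i i w w' hi)) orbF eq_sym (negbTE (nVW i' i w' w hi')) /=.
  by move=> /esym/eqP Ew /esym/eqP Ei; rewrite (injD _ _ _ iV Ei) (injD _ _ _ wW Ew).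
apply/subset_leq_card/subsetP => _ /imsetP[[i w] hi ->].
have [i2 iV wW v2i] := JP _ _ hi.
rewrite !inE cards2 (nVW i i w w) // andbT; apply/(maximal_matchingP Tn133_sym); split.
  apply/matchingP; split.
    apply/subsetP => m /set2P[]->; [apply: triangleD1 Tn133_sym _ _ triangleV _ | apply: triangleD1 Tn133_sym _ _ triangleW _]; done.
  have d z : z \in V :\ i -> z \in W :\ w -> False.
    by rewrite !in_setD1 => /andP[_ zV] /andP[_]; rewrite (disjointFr disjointVW zV).
  by move=> a b z /set2P[]-> /set2P[]-> // za zb; case: (d z).
have sub m z : m \in h (i, w) -> z \in m -> z \in cover (h (i, w)).
  by move=> mh zm; apply/bigcupP; exists m.
have sub' z : (z \in V :\ i) || (z \in W :\ w) -> z \in cover (h (i, w)).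
  by case/orP; apply: sub; rewrite ?set21 ?set22.
move=> x y exy; have : ((x \in V :\ i) || (x \in W :\ w)) || ((y \in V :\ i) || (y \in W :\ w)).
  by move: (Tn133_cases exy) iV wW; rewrite !in_setD1 !inV !inW -!val_eqE /=; lia.
by case/orP => /sub' ->; rewrite ?orbT.
Qed.

End Extremal.

(** At least four vertices are covered, two by each edge. *)
Lemma card_matching_ge2 (T : finType) (e : rel T) (M : {set {set T}}) (X Y : {set T}) :
  irreflexive e -> matching e M -> [disjoint X & Y] ->
  1 < #|cover M :&: X| -> 1 < #|cover M :&: Y| -> 1 < #|M|.
Proof.
move=> eI mM dXY cX cY; have := card_cover_matching eI mM.
have : #|cover M :&: X :|: cover M :&: Y| <= #|cover M|.
  by apply: subset_leq_card; rewrite subUset !subsetIl.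
rewrite card_setU_disjoint; first by lia.
by move=> x; rewrite !inE => /andP[_ xX]; rewrite (disjointFr dXY xX) andbF.
Qed.

(** * Averages in terms of the number of matchings of size two *)

Section Averages.
Variables (T : finType) (e : rel T).
Local Notation total := (\sum_(M in maximal_matchings e) #|M|).
Hypothesis ge2 : {in maximal_matchings e, forall M : {set {set T}}, 1 < #|M|}.

Lemma card_maximal_split :
  #|maximal_matchings e| = #|small_maximal e| + #|large_maximal e|.
Proof.
rewrite -card_setU_disjoint; last by move=> M; rewrite !inE => /andP[_ /eqP->]; rewrite andbF.
apply: eq_card => M; apply/idP/setUP => [mM|[]/setIdP[] //].
by have := ge2 mM; rewrite leq_eqVlt => /orP[]h; [left|right]; apply/setIdP; rewrite // eq_sym.
Qed.

Lemma card_smallE : #|small_maximal e| = \sum_(M in maximal_matchings e) (#|M| == 2).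
Proof.
rewrite -sum1_card big_mkcond [RHS]big_mkcond; apply: eq_bigr => M _.
by rewrite in_set; case: (M \in maximal_matchings e) => //=; case: eqP.
Qed.

(** Each size satisfies [3 <= #|M| + (#|M| == 2)] once it is at least 2; the reverse inequality in
    [total_le] needs size at most 3. *)
Lemma total_ge : 3 * #|maximal_matchings e| <= total + #|small_maximal e|.
Proof.
rewrite mulnC -sum_nat_const card_smallE -big_split /=; apply: leq_sum => M /ge2.
by case: #|M| => [|[|[|m]]].
Qed.

Lemma total_le : {in maximal_matchings e, forall M : {set {set T}}, #|M| <= 3} ->
  total + #|small_maximal e| <= 3 * #|maximal_matchings e|.
Proof.
move=> le3; rewrite mulnC -sum_nat_const card_smallE -big_split /=; apply: leq_sum => M mM.
by move: (le3 _ mM); case: #|M| => [|[|[|[|m]]]].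
Qed.

End Averages.

Lemma card_maximal_gt0 (T : finType) (e : rel T) : 0 < #|maximal_matchings e|.
Proof.
by have [M mM _] := matching_extend (matching0 e); apply/card_gt0P; exists M; rewrite inE.
Qed.

(** With [N] maximal matchings, [s] of them of size 2, the average is at most [3 - s/N] for the
    first graph and at least [3 - s/N] for the second, so it suffices to compare the ratios
    [s/N]. *)
Lemma avm_lt (T1 T2 : finType) (e1 : rel T1) (e2 : rel T2) :
  {in maximal_matchings e1, forall M : {set {set T1}}, #|M| <= 3} ->
  {in maximal_matchings e2, forall M : {set {set T2}}, 1 < #|M|} ->
  #|small_maximal e2| * #|maximal_matchings e1| < #|small_maximal e1| * #|maximal_matchings e2| ->
  (avm e1 < avm e2)%R.
Proof.
move=> le3 ge2 lt; have := total_le le3; have := total_ge ge2; move: lt; rewrite /avm.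
have := card_maximal_gt0 e1; have := card_maximal_gt0 e2.
move: #|maximal_matchings e1| #|maximal_matchings e2| => N1 N2.
move: #|small_maximal e1| #|small_maximal e2| (\sum_(M in _) _) (\sum_(M in _) _).
move=> s1 s2 t1 t2 N2_gt0 N1_gt0 lt le2 le1.
rewrite ltr_pdivrMr ?ltr0n // mulrAC ltr_pdivlMr ?ltr0n // -!natrM ltr_nat.
have := leq_mul le1 (leqnn N2); have := leq_mul le2 (leqnn N1); nia.
Qed.

Theorem theorem4p6 (n : nat) (T : finType) (e : rel T) :
  7 <= n ->
  simple_graph e ->
  #|T| = n ->
  connected_graph e ->
  #|edges e| = n.+1 ->
  has_two_disjoint_cycles e ->
  ~ graph_iso e (Tn133 n) ->
  (avm (Tn133 n) < avm e)%R.
Proof.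
move=> n7 [eS eI] cT conn cE [s1 [s2 [c1 c2 d12]]] niso; subst n.
have ge2 : {in maximal_matchings e, forall M : {set {set T}}, 1 < #|M|}.
  move=> M; rewrite inE => /(maximal_matchingP eS)[mM cov].
  apply: (card_matching_ge2 eI mM _ (vertex_cover_cycle eS eI c1 cov) (vertex_cover_cycle eS eI c2 cov)).
  by rewrite disjoint_subset; apply/subsetP => x; rewrite !inE; apply: (allP d12).
have ge2T : {in maximal_matchings (Tn133 #|T|), forall M : {set {set 'I_#|T|}}, 1 < #|M|}.
  move=> M; rewrite inE => /(maximal_matchingP (@Tn133_sym _))[mM cov].
  exact: (card_matching_ge2 (@Tn133_irr _) mM (disjointVW n7)
    (triangle_vertex_cover (triangleV n7) cov) (triangle_vertex_cover (triangleW n7) cov)).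
have le3T : {in maximal_matchings (Tn133 #|T|), forall M : {set {set 'I_#|T|}}, #|M| <= 3}.
  by move=> M; rewrite inE => /andP[mM _]; have [] := Tn133_matching3 n7 mM.
have main : #|small_maximal e| * (3 * (#|T| - 6) + 1) < 6 * #|large_maximal e|.
  case: (set_0Vmem (small_maximal e)) => [E|[M sM]].
    (* Some maximal matching exists, so [large_maximal e] is nonempty. *)
    have := card_maximal_gt0 e; rewrite card_maximal_split // E cards0 mul0n add0n; lia.
  have [A [B [tA tB dAB indep]]] := small_maximal_triangles eS eI conn cE c1 c2 d12 sM.
  pose t r := odflt r [pick u | e r u].
  have ht r : r \notin A -> r \notin B -> e r (t r) /\ (t r \in A) || (t r \in B).
    move=> rA rB; have er : e r (t r).
      rewrite /t; case: pickP => // H; have [|u eu] := has_neighbour conn r; first by lia.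
      by rewrite H in eu.
    split=> //; apply: contraT; rewrite negb_or => /andP[tA' tB'].
    by have := indep _ _ rA rB tA' tB'; rewrite er.
  have R0 : 0 < #|~: (A :|: B)| by have := card_outside tA tB dAB; lia.
  (* By symmetry the triangle with at least as many chosen attachments takes the role of [A]. *)
  case: (leqP #|[set r in ~: (A :|: B) | t r \in B]| #|[set r in ~: (A :|: B) | t r \in A]|) => le.
    exact: (small_lt_large eS eI conn cE tA tB dAB indep ht).
  have dBA : [disjoint B & A] by rewrite disjoint_sym.
  apply: (small_lt_large eS eI conn cE tB tA dBA _ (t := t)) => //.
  - by move=> x y xB xA yB yA; apply: indep.
  - by move=> r rB rA; rewrite orbC; apply: ht.
  - by rewrite setUC.
  - by rewrite (setUC B A) ltnW.
(* The terms [s * s'] cancel and [s * l' < s' * l] remains; it follows from [main] through [l' <= K]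
   and [6 <= s']. *)
apply: avm_lt => //; rewrite !card_maximal_split //.
have := card_small_Tn133 n7; have := card_large_Tn133 n7.
set s := #|small_maximal e| in main *; set l := #|large_maximal e| in main *.
set s' := #|small_maximal (Tn133 _)|; set l' := #|large_maximal (Tn133 _)|; set K := (_ + 1) in main * => lK s6.
have h1 : s * l' <= s * K by rewrite leq_mul2l lK orbT.
have h2 : 6 * l <= s' * l by rewrite leq_mul2r s6 orbT.
rewrite !mulnDr (mulnC s' s) ltn_add2l.
exact: leq_ltn_trans h1 (leq_trans main h2).
Qed.
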